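(* Let $G$ be a countably infinite group with identity $e$ and let $H\subseteq G\setminus\{e\}$ be a vdC set in $G$. Then there are infinitely many pairwise disjoint subsets of $H$, each of which is a vdC set in $G$.
   Context: A measure preserving system $(X,\mathcal{B},\mu,(T_g)_{g\in G})$ is a probability space $(X,\mathcal{B},\mu)$ together with an action $(T_g)_{g\in G}$ of $G$ on $X$ by measure preserving maps (so $T_g\circ T_h=T_{gh}$). For a countable group $G$, a set $H\subseteq G\setminus\{e\}$ is a vdC set in $G$ if for every measure preserving system $(X,\mathcal{B},\mu,(T_g)_{g\in G})$ and every (complex valued) $f\in L^\infty(\mu)$: if $\int_{X}f(T_hx)\overline{f(x)}\,d\mu(x)=0$ for all $h\in H$, then $\int_{X}f\,d\mu=0$. *)

(* Defs.v *)
From HB Require Import structures.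
From mathcomp Require Import all_boot all_order all_algebra.
From mathcomp Require Import complex.
From mathcomp Require Import all_classical all_reals all_analysis.

Set Implicit Arguments.
Unset Strict Implicit.
Unset Printing Implicit Defensive.

Import Order.TTheory GRing.Theory Num.Theory.

Local Open Scope classical_set_scope.
Local Open Scope ring_scope.

Record measure_preserving_action (G : groupType) (R : realType)
    (d : measure_display) (X : measurableType d) (mu : probability X R)
    (T : G -> X -> X) : Prop := {
  mpa_one : forall x, T 1%g x = x ;
  mpa_mul : forall g h x, T g (T h x) = T (g * h)%g x ;
  mpa_measurable : forall g, measurable_fun [set: X] (T g) ;
  mpa_preserving : forall g (A : set X), measurable A -> mu (T g @^-1` A) = mu A
}.

(* R[i] carries no sigma-algebra in the library; Borel measurability of a
   complex function is measurability of its real and imaginary parts. *)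
Definition complex_measurable (R : realType) (d : measure_display)
    (X : measurableType d) (f : X -> R[i]) : Prop :=
  measurable_fun [set: X] (fun x => complex.Re (f x)) /\
  measurable_fun [set: X] (fun x => complex.Im (f x)).

(* Functions are not quotiented by almost everywhere equality: f is a
   representative of its class. *)
Definition complex_Linfty (R : realType) (d : measure_display)
    (X : measurableType d) (mu : probability X R) (f : X -> R[i]) : Prop :=
  complex_measurable f /\ finite_norm mu +oo%E (fun x => ComplexField.Normc.normc (f x)).

Definition complex_integral (R : realType) (d : measure_display)
    (X : measurableType d) (mu : probability X R) (f : X -> R[i]) : R[i] :=
  Complex (\int[mu]_x complex.Re (f x)) (\int[mu]_x complex.Im (f x)).

Definition vdC_set (R : realType) (G : groupType) (H : set G) : Prop :=
  H `<=` ~` [set 1%g] /\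
  forall (d : measure_display) (X : measurableType d) (mu : probability X R)
    (T : G -> X -> X), measure_preserving_action mu T ->
  forall f : X -> R[i], complex_Linfty mu f ->
    (forall h, H h -> complex_integral mu (fun x => f (T h x) * conjc (f x)) = 0) ->
    complex_integral mu f = 0.

(* Main.v *)
(* Let [H] be a vdC set.

   Compactness: for every [e > 0] some finite [K] included in [H] already forces
   [|int f| <= e] whenever [|f| <= 1] is orthogonal to its translates by [K].
   Otherwise there are counterexamples for finite sets exhausting [H]; their
   ultraproduct, with the Loeb measure (the Caratheodory extension of the
   ultralimit of the measures), is a system that violates the vdC property of [H].

   Deletion: [H] minus finitely many points is still a vdC set.  Given [f] that is
   orthogonal to its translates by [H \ {h}], multiply it, in the product with the
   Bernoulli shift on [{0,1}^G], by the indicator of [x 1 = 1, x h = 0]: this event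
   is disjoint from its translate by [h], and has probability [1/4].

   Hence one finds disjoint finite sets [K n] in [H] that are good for
   [e = 1/(n+1)]; the union of infinitely many of them is a vdC set, and [nat]
   splits into infinitely many infinite sets. *)
From HB Require Import structures.
Require Import Defs.
From mathcomp Require Import all_boot all_order all_algebra.
From mathcomp Require Import complex.
From mathcomp Require Import all_classical all_reals all_analysis.
From mathcomp Require Import measurable_realfun ess_sup_inf.
From mathcomp Require Import ring lra.

Set Implicit Arguments.
Unset Strict Implicit.
Unset Printing Implicit Defensive.

Import Order.TTheory GRing.Theory Num.Theory.
Import numFieldNormedType.Exports.

Local Open Scope classical_set_scope.
Local Open Scope ring_scope.

(** * Limits of bounded real sequences along a free ultrafilter *)

Definition ultra : set_system nat :=
  sval (cid (ultraFilterLemma eventually_filter)).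

Instance ultra_ultra : UltraFilter ultra.
Proof. by rewrite /ultra; case: cid => F []. Qed.

Lemma ultra_eventually (A : set nat) : (\forall n \near \oo, A n) -> ultra A.
Proof. by rewrite /ultra; case: cid => F /= [_]; apply. Qed.

Lemma ultraI (A B : set nat) : ultra A -> ultra B -> ultra (A `&` B).
Proof. exact: filterI. Qed.

Lemma ultraN (A : set nat) : ~ ultra A <-> ultra (~` A).
Proof.
split => [nA|nA uA]; first by have [] := in_ultra_setVsetC A ultra_ultra.
have /filter_ex[? []//] := ultraI uA nA.
Qed.

Lemma ultra_geq m : ultra [set n | (m <= n)%N].
Proof. by apply: ultra_eventually; exists m. Qed.

Definition ulim (R : realType) (u : nat -> R) : R := lim (u n @[n --> ultra]).

(** Compactness of [[- M, M]] yields a cluster point, and an ultrafilter converges to each of its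
    cluster points. Since [lim] is total, boundedness is what gives [ulim] its meaning here. *)
Lemma ulim_cvg (R : realType) (u : nat -> R) (M : R) :
  (forall n, `|u n| <= M) -> u n @[n --> ultra] --> ulim u.
Proof.
move=> uM.
have /(_ (u n @[n --> ultra]) _) : compact `[- M, M]%classic by exact: segment_compact.
case.
  by apply: (@filterS _ ultra _ setT) => [n _|]; [rewrite /= in_itv/= -ler_norml|exact: filterT].
move=> p [_ clp].
suff up : u n @[n --> ultra] --> p by rewrite /ulim (cvg_lim _ up).
(* A neighbourhood outside the image ultrafilter would have its complement inside, and a cluster
   point would force the two to meet. *)
move=> N Np; apply: contrapT => /ultraN nN.
by have [? []] := clp (~` N) N nN Np.
Qed.

Section ulim_theory.
Context (R : realType).
Implicit Types (u v : nat -> R) (M : R).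

Lemma eq_ulim u v : ultra [set n | u n = v n] -> ulim u = ulim v.
Proof.
move=> uv; congr (lim _); apply/predeqP => A; split => uA.
  by apply: filterS (ultraI uv uA) => n [/= <-].
by apply: filterS (ultraI uv uA) => n [/= ->].
Qed.

Lemma ulim_cst (c : R) : ulim (fun=> c) = c.
Proof. by apply/cvg_lim => //; exact: cvg_cst. Qed.

Lemma ulimD u v M : (forall n, `|u n| <= M) -> (forall n, `|v n| <= M) ->
  ulim (fun n => u n + v n) = ulim u + ulim v.
Proof.
by move=> uM vM; apply/cvg_lim => //; apply: cvgD; apply: ulim_cvg; eauto.
Qed.

Lemma ulimM u v M : (forall n, `|u n| <= M) -> (forall n, `|v n| <= M) ->
  ulim (fun n => u n * v n) = ulim u * ulim v.
Proof.
by move=> uM vM; apply/cvg_lim => //; apply: cvgM; apply: ulim_cvg; eauto.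
Qed.

Lemma ulimB u v M : (forall n, `|u n| <= M) -> (forall n, `|v n| <= M) ->
  ulim (fun n => u n - v n) = ulim u - ulim v.
Proof.
by move=> uM vM; apply/cvg_lim => //; apply: cvgB; apply: ulim_cvg; eauto.
Qed.

Lemma ulim_norm u M : (forall n, `|u n| <= M) -> ulim (fun n => `|u n|) = `|ulim u|.
Proof. by move=> uM; apply/cvg_lim => //; apply: cvg_norm; apply: ulim_cvg; eauto. Qed.

Lemma ler_ulim u v M : (forall n, `|u n| <= M) -> (forall n, `|v n| <= M) ->
  ultra [set n | u n <= v n] -> ulim u <= ulim v.
Proof.
move=> uM vM uv.
rewrite -subr_ge0; apply: (cvgr_to_ge (f := fun n => v n - u n) (F := ultra)).
  by apply: cvgB; apply: ulim_cvg; eauto.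
by apply: filterS uv => n; rewrite /= subr_ge0.
Qed.

Lemma ulim_bounded u M : (forall n, `|u n| <= M) -> `|ulim u| <= M.
Proof.
move=> uM; rewrite -(ulim_norm uM) -[leRHS]ulim_cst.
apply: (@ler_ulim _ _ `|M|) => [n|n|].
- by rewrite normr_id (le_trans (uM n))// ler_norm.
- by [].
- by apply: (@filterS _ ultra _ setT); [move=> n _; exact: uM|exact: filterT].
Qed.

End ulim_theory.

(** * Ultraproducts of measurable spaces and their internal sets *)

Definition uprod (d : nat -> measure_display)
  (X : forall n, measurableType (d n)) : Type := forall n, X n.

Section internal.
Context (d : nat -> measure_display) (X : forall n, measurableType (d n)).
Implicit Types A B : forall n, set (X n).

HB.instance Definition _ := gen_eqMixin (uprod X).
HB.instance Definition _ := gen_choiceMixin (uprod X).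
HB.instance Definition _ := isPointed.Build (uprod X) (fun n => point).

(** No quotient of [uprod X] is taken: internal sets do not separate sequences that agree on a set
    of [ultra], so they form the same algebra as in the usual ultraproduct. *)
Definition internal A : set (uprod X) := [set x | ultra [set n | A n (x n)]].

Lemma eq_internal A B : ultra [set n | A n = B n] -> internal A = internal B.
Proof.
move=> AB; apply/seteqP; split => x Ax; apply: filterS (ultraI AB Ax) => n /=;
  by [move=> [<-]|move=> [->]].
Qed.

Lemma internalC A : internal (fun n => ~` A n) = ~` internal A.
Proof. by apply/seteqP; split => x /ultraN. Qed.

Lemma internalI A B :
  internal (fun n => A n `&` B n) = internal A `&` internal B.
Proof.
apply/seteqP; split => x; last by move=> [Ax Bx]; apply: filterI.
by move=> ABx; split; apply: filterS ABx => n [].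
Qed.

Lemma internalU A B :
  internal (fun n => A n `|` B n) = internal A `|` internal B.
Proof.
rewrite -[RHS]setCK setCU -!internalC -internalI -internalC.
by apply: eq_internal; apply: filterE => n /=; rewrite setCI !setCK.
Qed.

Lemma internal0 : internal (fun n => set0) = set0.
Proof. by apply/seteqP; split => x // /filter_ex[]. Qed.

Lemma internal_nonempty A : internal A !=set0 <-> ultra [set n | A n !=set0].
Proof.
split => [[x Ax]|A0]; first by apply: filterS Ax => n /= ?; exists (x n).
exists (fun n => xget point (A n)); apply: filterS A0 => n [x Ax].
exact: (xgetI _ Ax).
Qed.

(** If [A n] escapes [B n] for [ultra]-many [n], choosing an escaping point in each coordinate gives
    a point of [internal A] outside [internal B]. *)
Lemma internal_inj A B : internal A = internal B -> ultra [set n | A n = B n].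
Proof.
have sub A' B' : internal A' = internal B' -> ultra [set n | A' n `<=` B' n].
  move=> AB; apply: contrapT => /ultraN nAB.
  have [x] : internal (fun n => A' n `&` ~` B' n) !=set0.
    apply/internal_nonempty; apply: filterS nAB => n /= nAB.
    apply: contrapT => AB0; apply: nAB => x Ax; apply: contrapT => Bx.
    by apply: AB0; exists x.
  by rewrite internalI internalC AB => -[].
move=> AB; apply: filterS (ultraI (sub _ _ AB) (sub _ _ (esym AB))).
by move=> n [] *; apply/seteqP.
Qed.

(** Countable saturation, by a diagonal choice: coordinate [n] is a common point of the first [m]
    sets for the largest [m <= n] that allows one. For fixed [k], [ultra]-many [n] are at least
    [k.+1] and have a common point of the first [k.+1] sets, so that the chosen point lies in
    [B k n]. *)
Lemma internal_saturation (B : nat -> forall n, set (X n)) :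
  (forall m, internal (fun n => \bigcap_(k < m) B k n) !=set0) ->
  exists x, forall k, internal (B k) x.
Proof.
move=> B0; pose C n m := \bigcap_(k < m) B k n.
have xE n : {x : X n | forall m, (m <= n)%N -> C n m !=set0 -> C n m x}.
  apply: cid.
  (* The bound on [m] is separated from the coordinate [n], which stays fixed during the
     induction. *)
  suff: forall N, exists x, forall m, (m <= N)%N -> C n m !=set0 -> C n m x by exact.
  elim=> [|N [x xC]].
    by exists point => m; rewrite leqn0 => /eqP-> _ ?.
  have [[y Cy]|C0] := pselect (C n N.+1 !=set0).
    exists y => m mN _ k /= km; apply: Cy => /=; exact: leq_trans mN.
  exists x => m; rewrite leq_eqVlt => /orP[/eqP -> //|]; rewrite ltnS; exact: xC.
exists (fun n => sval (xE n)) => k.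
have /internal_nonempty Bk := B0 k.+1.
apply: filterS (ultraI (ultra_geq k.+1) Bk) => n [/= kn Ck].
by have := svalP (xE n) k.+1 kn Ck; apply => /=.
Qed.

Definition internal_measurable : set (set (uprod X)) :=
  [set internal A | A in [set A | forall n, measurable (A n)]].

Lemma internal_measurable0 : internal_measurable set0.
Proof. by exists (fun=> set0); [move=> n /=; exact: measurable0|exact: internal0]. Qed.

Lemma internal_measurableU : setU_closed internal_measurable.
Proof.
move=> _ _ [A mA <-] [B mB <-]; exists (fun n => A n `|` B n).
  by move=> n /=; apply: measurableU.
exact: internalU.
Qed.

Lemma internal_measurableC : setC_closed internal_measurable.
Proof.
move=> _ [A mA <-]; exists (fun n => ~` A n) => [n /=|]; first exact: measurableC.
exact: internalC.
Qed.

Definition internal_display : measure_display. Proof. exact: sigma_display internal_measurable. Qed.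

HB.instance Definition _ := isAlgebraOfSets.Build internal_display
  (uprod X) internal_measurable0 internal_measurableU internal_measurableC.

End internal.

(** * The Loeb measure *)

Lemma normr_fine_probability (R : realType) d (X : measurableType d)
    (P : probability X R) (A : set X) : measurable A -> `|fine (P A)| <= 1.
Proof.
move=> mA; rewrite ger0_norm ?fine_ge0// -lee_fin fineK ?probability_le1//.
exact: fin_num_measure.
Qed.

Section loeb.
Context (R : realType) (d : nat -> measure_display).
Context (X : forall n, measurableType (d n)) (mu : forall n, probability (X n) R).
Implicit Types A B : forall n, set (X n).

(** The content must depend on the set alone, so a representing sequence is chosen; [internal_inj]
    makes the choice irrelevant up to [ultra]. The default [set0] keeps every term measurable even
    when [S] is not internal. *)
Definition internal_rep (S : set (uprod X)) : forall n, set (X n) :=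
  xget (fun=> set0) [set B | (forall n, measurable (B n)) /\ internal B = S].

Arguments internal_rep S n : clear implicits.

Lemma measurable_internal_rep (S : set (uprod X)) (n : nat) :
  measurable (internal_rep S n : set (X n)).
Proof.
by rewrite /internal_rep; case: xgetP => [B -> [+ _]|_]; [apply|exact: measurable0].
Qed.

Definition loeb_content (S : set (uprod X)) : \bar R :=
  (ulim (fun n => fine (mu n (internal_rep S n))))%:E.

Lemma loeb_contentE B : (forall n, measurable (B n)) ->
  loeb_content (internal B) = (ulim (fun n => fine (mu n (B n))))%:E.
Proof.
move=> mB; rewrite /loeb_content; congr EFin; apply: eq_ulim.
have /internal_inj : internal (internal_rep (internal B)) = internal B.
  by rewrite {1}/internal_rep; case: xgetP => [? -> []//|/(_ B)[]].
by apply: filterS => n /= ->.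
Qed.

Lemma loeb_content0 : loeb_content set0 = 0%E.
Proof.
rewrite -[X in loeb_content X]internal0 loeb_contentE//.
rewrite (@eq_ulim _ _ (fun=> 0)) ?ulim_cst//.
by apply: filterE => n /=; rewrite measure0.
Qed.

Lemma loeb_content_ge0 S : (0 <= loeb_content S)%E.
Proof.
rewrite lee_fin -[leLHS]ulim_cst; apply: (@ler_ulim _ _ _ 1) => [n|n|].
- by rewrite normr0.
- exact/normr_fine_probability/measurable_internal_rep.
- by apply: filterE => n /=; rewrite fine_ge0.
Qed.

Lemma loeb_content_semi_additive : measure_function.semi_additive loeb_content.
Proof.
apply/(additive2P loeb_content0) => _ _ [A mA <-] [B mB <-] AB0.
rewrite -internalU !loeb_contentE//; last by move=> n; exact: measurableU.
rewrite -EFinD -(@ulimD _ _ _ 1); last 2 first.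
- by move=> n; exact/normr_fine_probability/mA.
- by move=> n; exact/normr_fine_probability/mB.
congr EFin; apply: eq_ulim.
have : internal (fun n => A n `&` B n) = internal (fun n => set0).
  by rewrite internalI internal0.
move=> /internal_inj; apply: filterS => n /= AB.
have {}mA := mA n; have {}mB := mB n.
by rewrite measureU// fineD//; exact: fin_num_measure.
Qed.

HB.instance Definition _ := isContent.Build _ (uprod X) R loeb_content
  loeb_content_ge0 loeb_content_semi_additive.

(** By saturation, a countable cover of an internal set by internal sets has a finite subcover, so
    countable subadditivity reduces to finite subadditivity. This is the hypothesis of the
    Caratheodory extension. *)
Lemma loeb_content_sigma_subadditive :
  measurable_subset_sigma_subadditive loeb_content.
Proof.
move=> S F mF [A mA <-] AF.
have /choice[f fF] : forall k, exists B, (forall n, measurable (B n)) /\ internal B = F k.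
  by move=> k; have [B mB BF] := mF k; exists B.
suff [m Am] : exists m, internal A `<=` \big[setU/set0]_(k < m) F k.
  apply: le_trans (nneseries_lim_ge m _); last by move=> *; exact: loeb_content_ge0.
  rewrite big_mkord; apply: (content_subadditive loeb_content) => //.
  by exists A.
apply: contrapT => nAm.
(* Without a finite subcover these sets have the finite intersection property; a common point lies
   in [internal A] and in no [F k]. *)
pose B k := if k is k'.+1 then fun n => ~` f k' n else A.
have [m|x xB] := @internal_saturation _ X B.
  have /existsNP[x /not_implyP[Ax nFx]] :
      ~ internal A `<=` \big[setU/set0]_(k < m) F k.
    by move=> Am; apply: nAm; exists m.
  exists x; suff : forall p, (p <= m.+1)%N ->
      internal (fun n => \bigcap_(k < p) B k n) x.
    by apply; exact: leqnSn.
  elim=> [_|p IHp pm].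
    by apply: filterE => n k.
  have Bpx : internal (B p) x.
    case: p => [//|p] in IHp pm *; rewrite /B internalC (fF p).2 => Fpx.
    apply: nFx; rewrite -bigcup_mkord; exists p => //=.
  apply: filterS (ultraI (IHp (ltnW pm)) Bpx) => n [Bk Bp] k /=.
  by rewrite ltnS leq_eqVlt => /orP[/eqP->|/Bk].
have [k _ Fkx] := AF x (xB 0%N).
by have := xB k.+1; rewrite /= internalC (fF k).2.
Qed.

HB.instance Definition _ := Content_SigmaSubAdditive_isMeasure.Build _ R
  (uprod X) loeb_content loeb_content_sigma_subadditive.

End loeb.

Definition loeb_space (d : nat -> measure_display)
    (X : forall n, measurableType (d n)) : measurableType _ :=
  g_sigma_algebraType (@measurable _ (uprod X)).

Section loeb_measure.
Context (R : realType) (d : nat -> measure_display).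
Context (X : forall n, measurableType (d n)) (mu : forall n, probability (X n) R).
Implicit Types A B : forall n, set (X n).

Lemma measurable_internal B : (forall n, measurable (B n)) ->
  measurable (internal B : set (loeb_space X)).
Proof. by move=> mB; apply: sub_sigma_algebra; exists B. Qed.

Definition loeb : set (loeb_space X) -> \bar R := measure_extension (loeb_content mu).

HB.instance Definition _ := Measure.copy loeb (measure_extension (loeb_content mu)).

Lemma loebE B : (forall n, measurable (B n)) ->
  loeb (internal B) = (ulim (fun n => fine (mu n (B n))))%:E.
Proof.
move=> mB; rewrite -(loeb_contentE mu)//.
rewrite /loeb /measure_extension/= measurable_mu_extE//.
by exists B.
Qed.

Lemma loeb_setT : loeb setT = 1%E.
Proof.
rewrite -setC0 -internal0 -internalC loebE; last by move=> n; rewrite setC0.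
rewrite (@eq_ulim _ _ (fun=> 1)) ?ulim_cst//.
by apply: filterE => n /=; rewrite setC0 probability_setT.
Qed.

HB.instance Definition _ := Measure_isProbability.Build _ _ _ loeb loeb_setT.

End loeb_measure.

(** * Integrals of bounded functions and of ultralimits *)

Section bounded_integrals.
Context (R : realType) d (X : measurableType d) (P : probability X R).
Implicit Types (F G : X -> R) (A : set X) (M : R).

Lemma bounded_integrable F M : measurable_fun setT F ->
  (forall x, `|F x| <= M) -> P.-integrable setT (EFin \o F).
Proof.
move=> mF FM; apply: measurable_bounded_integrable => //.
  by rewrite -ge0_fin_numE// fin_num_measure.
by exists M; split; [exact: num_real|] => y My x _; exact: le_trans (FM x) (ltW My).
Qed.

Lemma Rintegral_cst_probability (c : R) : \int[P]_x c = c.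
Proof. by rewrite Rintegral_cst// (congr1 fine (probability_setT P)) mulr1. Qed.

Lemma normr_Rintegral_le F M : measurable_fun setT F ->
  (forall x, `|F x| <= M) -> `|\int[P]_x F x| <= M.
Proof.
move=> mF FM; have iF := bounded_integrable mF FM.
apply: le_trans (le_normr_Rintegral _ iF) _ => //.
have -> : M = \int[P]_x (cst M x).
  exact/esym/Rintegral_cst_probability.
apply: le_Rintegral => //.
- exact: integrable_norm.
- by apply: (@bounded_integrable _ `|M|) => //.
Qed.

Lemma Rintegral_indic_probability A : measurable A ->
  \int[P]_x \1_A x = fine (P A).
Proof. by move=> mA; rewrite /Rintegral integral_indic// setIT. Qed.

(** Compares a function with a step function. It serves on each factor and on the Loeb space alike,
    with [c] making the function nonnegative and [A i] its superlevel sets. *)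
Lemma step_integral F c delta N (A : nat -> set X) M :
  measurable_fun setT F -> (forall x, `|F x| <= M) ->
  (forall i, measurable (A i)) ->
  let S x := \sum_(i < N) delta * \1_(A i) x in
  measurable_fun setT (fun x => F x + c - S x) /\
  \int[P]_x (F x + c - S x) = \int[P]_x F x + c - \sum_(i < N) delta * fine (P (A i)).
Proof.
move=> mF FM mA S.
have iF := bounded_integrable mF FM.
have icst : P.-integrable setT (EFin \o cst c).
  exact: (@bounded_integrable _ `|c|).
have iind i : P.-integrable setT (EFin \o (fun x => \1_(A i) x : R)).
  apply: (@bounded_integrable _ 1); first exact: measurable_indic.
  by move=> x; rewrite indicE; case: (_ \in _); rewrite ?normr1 ?normr0.
suff [mI ->] : P.-integrable setT (EFin \o (fun x => F x + c - S x)) /\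
    \int[P]_x (F x + c - S x) = \int[P]_x F x + c - \sum_(i < N) delta * fine (P (A i)).
  by split => //; have /integrableP[/measurable_EFinP] := mI.
rewrite /S; elim: N {S} => [|N [iN IH]].
  under [in X in X /\ _]eq_fun do rewrite big_ord0 subr0.
  under eq_Rintegral do rewrite big_ord0 subr0.
  rewrite big_ord0 subr0; split.
    by apply: (integrableD _ iF icst).
  by rewrite RintegralD// Rintegral_cst_probability.
have iZ : P.-integrable setT (EFin \o (fun x => delta * \1_(A N) x)).
  by apply: (integrableZl _ delta (iind N)).
have SE x : F x + c - \sum_(i < N.+1) delta * \1_(A i) x =
    (F x + c - \sum_(i < N) delta * \1_(A i) x) - delta * \1_(A N) x.
  by rewrite big_ord_recr/= opprD addrA.
split.
  under [X in P.-integrable _ X]eq_fun do rewrite /= SE.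
  exact: (integrableB _ iN iZ).
under eq_Rintegral do rewrite SE.
rewrite RintegralB// IH RintegralZl// Rintegral_indic_probability//.
by rewrite big_ord_recr/= opprD addrA.
Qed.

End bounded_integrals.

(** For positive [delta] the sum counts the positive multiples of [delta] up to [z]: it is [z]
    rounded down to a multiple of [delta]. *)
Lemma step_bounds (R : realType) (delta z : R) N : 0 <= delta -> 0 <= z ->
  z <= N%:R * delta ->
  `|z - \sum_(i < N) delta * (i.+1%:R * delta <= z)%R%:R| <= delta.
Proof.
move=> d0 z0 zN.
have le_sum k : \sum_(i < k) delta * (i.+1%:R * delta <= z)%R%:R <= k%:R * delta.
  elim: k => [|k IH]; rewrite ?big_ord0 ?mul0r// big_ord_recr/= -natr1 mulrDl mul1r.
  by apply: lerD => //; case: (_ <= z); rewrite ?mulr1 ?mulr0.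
have le_z k : \sum_(i < k) delta * (i.+1%:R * delta <= z)%R%:R <= z.
  elim: k => [|k IH]; rewrite ?big_ord0//.
  have [kz|kz] := boolP (k.+1%:R * delta <= z); first exact: le_trans kz.
  by rewrite big_ord_recr/= (negbTE kz) mulr0 addr0.
rewrite ger0_norm ?subr_ge0// lerBlDl.
elim: N zN => [|N IH] zN.
  by rewrite big_ord0 add0r (le_trans zN)// mul0r.
(* Either the first [N] levels suffice, or [z] exceeds all of them and their terms add up to
   [N * delta]. *)
rewrite big_ord_recr/=; have [zN'|Nz] := leP z (N%:R * delta).
  by apply: le_trans (IH zN') _; rewrite -addrA lerD2l lerDr mulr_ge0.
apply: (le_trans zN); rewrite -natr1 mulrDl mul1r lerD2r.
rewrite ler_wpDr ?mulr_ge0//.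
rewrite (eq_bigr (fun=> delta)) ?sumr_const ?card_ord ?mulr_natl// => i _.
by rewrite (le_trans _ (ltW Nz)) ?mulr1// ler_wpM2r// ler_nat.
Qed.

Section loeb_integral.
Context (R : realType) (d : nat -> measure_display).
Context (X : forall n, measurableType (d n)) (mu : forall n, probability (X n) R).
Context (F : forall n, X n -> R) (M : R).
Arguments F : clear implicits.
Hypothesis mF : forall n, measurable_fun setT (F n).
Hypothesis FM : forall n x, `|F n x| <= M.

Lemma measurable_ulim :
  measurable_fun setT (fun x : loeb_space X => ulim (fun n => F n (x n))).
Proof.
apply: (measurability _ (RGenCInfty.measurableE R)) => /= _ [_ [c ->] <-].
rewrite setTI.
(* The slack [k.+1%:R^-1] cannot be dropped: an ultralimit may reach [c] while every term stays
   below [c]. *)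
rewrite (_ : _ @^-1` _ =
    \bigcap_k (internal (fun n => [set x | c - k.+1%:R^-1 <= F n x])
      : set (loeb_space X))); last first.
  apply/seteqP; split => x /=; rewrite in_itv/= andbT.
    move=> cF k _; have /cvgrPdist_lt := ulim_cvg (fun n => FM (x n)).
    move=> /(_ k.+1%:R^-1); rewrite invr_gt0 ltr0n => /(_ isT).
    apply: filterS => n /= /ltr_distlBl ?.
    by rewrite lerBlDr (le_trans cF)// -lerBlDr ltW// ltrBlDr -ltrBlDl.
  move=> xF; apply/ler_addgt0Pl => e e0.
  have [k ke] : exists k, k.+1%:R^-1 < e.
    by have [k _ /(_ k (leqnn k)) ke] := near_infty_natSinv_lt (PosNum e0); exists k.
  rewrite -lerBlDl (le_trans (y := c - k.+1%:R^-1)) ?lerD2l ?lerN2 ?(ltW ke)//.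
  rewrite -[leLHS]ulim_cst; apply: (@ler_ulim _ _ _ (`|c - k.+1%:R^-1| + M)) => [n|n|].
  - by rewrite lerDl (le_trans _ (FM (x 0%N))).
  - by rewrite (le_trans (FM _))// lerDr.
  - exact: (xF k).
apply: bigcapT_measurable => k; apply: measurable_internal => n.
rewrite (_ : [set x | _] = F n @^-1` `[c - k.+1%:R^-1, +oo[%classic).
  by rewrite -[X in measurable X]setTI; exact: mF.
by apply/seteqP; split => x; rewrite /= in_itv/= andbT.
Qed.

Lemma ulim_indic (A : forall n, set (X n)) (x : loeb_space X) :
  \1_(internal A : set (loeb_space X)) x = ulim (fun n => \1_(A n) (x n)) :> R.
Proof.
rewrite indicE; have [/set_mem Ax|] := boolP (_ \in _).
  rewrite (@eq_ulim _ _ (fun=> 1)) ?ulim_cst//.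
  by apply: filterS Ax => n /= Ax; rewrite indicE mem_set.
move=> /negP nAx; rewrite (@eq_ulim _ _ (fun=> 0)) ?ulim_cst//.
have /ultraN : ~ (internal A : set (loeb_space X)) x by move=> Ax; apply/nAx/mem_set.
by apply: filterS => n /= Ax; rewrite indicE memNset.
Qed.
End loeb_integral.

Lemma ulim_affine (R : realType) (a : nat -> R) (b : nat -> nat -> R) (c e K : R) N :
  (forall n, `|a n| <= K) -> (forall i n, `|b i n| <= K) ->
  ulim (fun n => a n + c - \sum_(i < N) e * b i n) =
  ulim a + c - \sum_(i < N) e * ulim (b i).
Proof.
move=> aK bK; apply/cvg_lim => //.
apply: cvgB; first by apply: cvgD; [exact: ulim_cvg aK|exact: cvg_cst].
elim: N => [|N IH].
  by rewrite big_ord0; under eq_fun do rewrite big_ord0; exact: cvg_cst.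
rewrite big_ord_recr/=; under eq_fun do rewrite big_ord_recr.
by apply: cvgD => //; apply: cvgM; [exact: cvg_cst|exact: ulim_cvg (bK _)].
Qed.

Section loeb_integral.
Context (R : realType) (d : nat -> measure_display).
Context (X : forall n, measurableType (d n)) (mu : forall n, probability (X n) R).
Context (F : forall n, X n -> R) (M : R).
Arguments F : clear implicits.
Hypothesis mF : forall n, measurable_fun setT (F n).
Hypothesis FM : forall n x, `|F n x| <= M.

(** Cut the range of [F + M] into [N] layers of height [e]. Both integrals, shifted by [M], are
    within [e] of the same sum [s], because [loebE] identifies the Loeb measure of each internal
    superlevel set with the ultralimit of the measures. *)
Lemma Rintegral_loeb :
  \int[loeb mu]_x ulim (fun n => F n (x n)) = ulim (fun n => \int[mu n]_x F n x).
Proof.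
set Fl := fun x : loeb_space X => _.
have FlM (x : loeb_space X) : `|Fl x| <= M.
  by apply: ulim_bounded => n; exact: FM.
have mFl : measurable_fun setT Fl by exact: measurable_ulim FM.
have M0 : 0 <= M by rewrite (le_trans _ (FM (point : X 0%N))).
have IM n : `|\int[mu n]_x F n x| <= M by exact: normr_Rintegral_le.
suff H (e : R) : 0 < e -> `|\int[loeb mu]_x Fl x - ulim (fun n => \int[mu n]_x F n x)| <= e + e.
  apply/eqP; rewrite -subr_eq0 -normr_le0; apply/ler_addgt0Pl => e e0.
  by rewrite addr0 (le_trans (H (e / 2) _)) ?divr_gt0// -splitr.
move=> e0.
have [N NM] : exists N, M + M <= N%:R * e.
  exists (Num.truncn ((M + M) / e)).+1.
  by rewrite -ler_pdivrMr// ltW// truncnS_gt.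
pose A i n := [set x : X n | i.+1%:R * e <= F n x + M].
have mA i n : measurable (A i n).
  rewrite (_ : A i n = F n @^-1` `[i.+1%:R * e - M, +oo[%classic).
    by rewrite -[X in measurable X]setTI; exact: mF.
  by apply/seteqP; split => x; rewrite /A/= in_itv/= andbT lerBlDr.
have indA i n (x : X n) : \1_(A i n) x = (i.+1%:R * e <= F n x + M)%R%:R :> R.
  rewrite indicE; case: (boolP (_ <= _)) => [?|/negP ?]; first by rewrite mem_set.
  by rewrite memNset.
have bound n (x : X n) :
    `|F n x + M - \sum_(i < N) e * \1_(A i n) x| <= e.
  under eq_bigr do rewrite indA.
  have /ler_normlP[FM1 FM2] := FM x.
  by apply: step_bounds; [exact: ltW|lra|rewrite (le_trans _ NM)// lerD2r].
pose s := \sum_(i < N) e * fine (loeb mu (internal (A i))).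
(* [ulim_affine] wants one bound for the functions or integrals, which [M] controls, and for the
   indicators or measures, which 1 controls. *)
pose K := Num.max M 1.
have MK (r : R) : `|r| <= M -> `|r| <= K by move=> rM; rewrite le_max rM.
have eK (r : R) : `|r| <= 1 -> `|r| <= K by move=> r1; rewrite le_max r1 orbT.
have H1 : `|\int[loeb mu]_x Fl x + M - s| <= e.
  have [m1 <-] := @step_integral _ _ _ (loeb mu) Fl M e N _ M mFl FlM
    (fun i => measurable_internal (mA i)).
  apply: normr_Rintegral_le => // x.
  under eq_bigr do rewrite ulim_indic.
  rewrite -(@ulim_affine _ _ (fun i n => \1_(A i n) (x n)) M e K).
  - by apply: ulim_bounded => n; exact: bound.
  - by move=> n; exact/MK/FM.
  - by move=> i n; apply: eK; rewrite indicE; case: (_ \in _); rewrite ?normr1 ?normr0.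
have H2 : `|ulim (fun n => \int[mu n]_x F n x) + M - s| <= e.
  rewrite /s; under eq_bigr do rewrite loebE//=.
  rewrite -(@ulim_affine _ _ (fun i n => fine (mu n (A i n))) M e K).
  - apply: ulim_bounded => n.
    have [m1 <-] := @step_integral _ _ _ (mu n) (F n) M e N (A^~ n) M (@mF n) (@FM n)
      (fun i => mA i n).
    exact: normr_Rintegral_le.
  - by move=> n; exact/MK/IM.
  - by move=> i n; exact/eK/normr_fine_probability/mA.
rewrite (_ : _ - _ = (\int[loeb mu]_x Fl x + M - s) -
   (ulim (fun n => \int[mu n]_x F n x) + M - s)); last by ring.
by rewrite (le_trans (ler_normB _ _))// lerD.
Qed.

End loeb_integral.

(** * Coordinatewise maps of Loeb spaces *)

Section loeb_map.
Context (R : realType) (d : nat -> measure_display).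
Context (X : forall n, measurableType (d n)) (mu : forall n, probability (X n) R).
Context (S : forall n, X n -> X n).
Arguments S : clear implicits.
Hypothesis mS : forall n, measurable_fun setT (S n).

Definition loeb_map (x : loeb_space X) : loeb_space X := fun n => S n (x n).

Let mSA (A : forall n, set (X n)) n : measurable (A n) -> measurable (S n @^-1` A n).
Proof. by move=> mA; rewrite -[X in measurable X]setTI; exact: mS. Qed.

Lemma measurable_loeb_map : measurable_fun setT loeb_map.
Proof.
apply: (@measurability _ _ (loeb_space X) (loeb_space X) setT loeb_map
  (@measurable _ (uprod X))) => // _ [_ [A mA <-] <-].
rewrite setTI; apply: (@measurable_internal _ _ (fun n => S n @^-1` A n)) => n.
exact/mSA/mA.
Qed.

(** The Loeb measure and its image agree on the internal measurable sets, which are closed under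
    intersection and generate the sigma-algebra. *)
Lemma loeb_map_preserving :
  (forall n A, measurable A -> mu n (S n @^-1` A) = mu n A) ->
  forall A, measurable A -> loeb mu (loeb_map @^-1` A) = loeb mu A.
Proof.
move=> pS A mA.
pose m1 : {measure set (loeb_space X) -> \bar R} := pushforward (loeb mu) loeb_map.
apply: (@measure_unique _ R (loeb_space X) (@measurable _ (uprod X)) (fun=> setT) _ _ _ _
  (m1 measurable_loeb_map) (loeb mu)) => //.
- exact: (@measurableI _ (uprod X)).
- by rewrite bigcup_const//; exists 0%N.
- move=> _ [B mB <-]; rewrite /pushforward/=.
  rewrite [loeb mu (internal B)]loebE//.
  rewrite [LHS](@loebE _ _ _ mu (fun n => S n @^-1` B n)); last first.
    by move=> n; exact/mSA/mB.
  by congr EFin; apply: eq_ulim; apply: filterE => n /=; rewrite pS//; exact: mB.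
- move=> _; have -> : m1 measurable_loeb_map setT = 1%E := loeb_setT mu.
  exact: ltry.
Qed.

End loeb_map.

(** * Systems with a bounded function, and compactness *)

Section system.
Context (R : realType) (G : groupType).

(* The bounded function of the system is [sys_u + i sys_v]. *)
Record system := System {
  sys_display : measure_display ;
  sys_space : measurableType sys_display ;
  sys_mu : probability sys_space R ;
  sys_act : G -> sys_space -> sys_space ;
  sys_mpa : measure_preserving_action sys_mu sys_act ;
  sys_u : sys_space -> R ;
  sys_v : sys_space -> R ;
  sys_mu_fun : measurable_fun setT sys_u ;
  sys_mv_fun : measurable_fun setT sys_v ;
  sys_u1 : forall x, `|sys_u x| <= 1 ;
  sys_v1 : forall x, `|sys_v x| <= 1 }.

(** With [im_corr], these are the real and imaginary parts of the integral of [f (T h x)] times the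
    conjugate of [f x], where [f = sys_u + i sys_v]. *)
Definition re_corr (s : system) (h : G) : R := \int[sys_mu s]_x
  (sys_u (sys_act h x) * sys_u x + sys_v (sys_act h x) * sys_v x).

Definition im_corr (s : system) (h : G) : R := \int[sys_mu s]_x
  (sys_v (sys_act h x) * sys_u x - sys_u (sys_act h x) * sys_v x).

Definition kills (s : system) (H : set G) :=
  forall h, H h -> re_corr s h = 0 /\ im_corr s h = 0.

(** A quantitative form of the vdC property: at [e = 0] it follows from the property, for [e > 0] it
    is within reach of finite sets, and for all [e > 0] together it gives the property back. *)
Definition vdC_upto (e : R) (H : set G) := forall s, kills s H ->
  `|\int[sys_mu s]_x sys_u x| <= e /\ `|\int[sys_mu s]_x sys_v x| <= e.

(** The ultraproduct system. [ulim] respects sums and products of bounded sequences, so the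
    correlation integrand of the limit is the ultralimit of the integrands, and [Rintegral_loeb]
    moves the ultralimit outside the integral. *)
Lemma limit_system (s : nat -> system) : exists t : system,
  [/\ \int[sys_mu t]_x sys_u x = ulim (fun n => \int[sys_mu (s n)]_x sys_u x),
      \int[sys_mu t]_x sys_v x = ulim (fun n => \int[sys_mu (s n)]_x sys_v x),
      forall h, re_corr t h = ulim (fun n => re_corr (s n) h) &
      forall h, im_corr t h = ulim (fun n => im_corr (s n) h)].
Proof.
pose X n := sys_space (s n).
pose mu n : probability (X n) R := sys_mu (s n).
pose T (g : G) : loeb_space X -> loeb_space X :=
  loeb_map (fun n => @sys_act (s n) g).
pose u (x : loeb_space X) : R := ulim (fun n => sys_u (x n : X n)).
pose v (x : loeb_space X) : R := ulim (fun n => sys_v (x n : X n)).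
have mT n g : measurable_fun setT (@sys_act (s n) g) by exact: (mpa_measurable (sys_mpa (s n))).
have act : measure_preserving_action (loeb mu) T.
  split.
  - by move=> x; apply: functional_extensionality_dep => n; exact: (mpa_one (sys_mpa (s n))).
  - move=> g h x; apply: functional_extensionality_dep => n.
    exact: (mpa_mul (sys_mpa (s n))).
  - by move=> g; exact: measurable_loeb_map.
  - move=> g; apply: loeb_map_preserving => // n A mA.
    exact: (mpa_preserving (sys_mpa (s n))).
have mu_ n := @sys_mu_fun (s n).
have mv_ n := @sys_mv_fun (s n).
have u1 n x := @sys_u1 (s n) x.
have v1 n x := @sys_v1 (s n) x.
have mu_u : measurable_fun setT u
  by apply: (@measurable_ulim _ _ X (fun n => @sys_u (s n)) 1).
have mu_v : measurable_fun setT v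
  by apply: (@measurable_ulim _ _ X (fun n => @sys_v (s n)) 1).
have uu (x : loeb_space X) : `|u x| <= 1 by apply: ulim_bounded => n.
have vv (x : loeb_space X) : `|v x| <= 1 by apply: ulim_bounded => n.
exists (System act mu_u mu_v uu vv); split => /=.
- exact: (@Rintegral_loeb _ _ _ mu (fun n => @sys_u (s n)) 1).
- exact: (@Rintegral_loeb _ _ _ mu (fun n => @sys_v (s n)) 1).
- move=> h.
  rewrite /re_corr /= -(@Rintegral_loeb _ _ _ mu (fun n x =>
    sys_u (sys_act h x) * sys_u x + sys_v (sys_act h x) * sys_v x) 2).
  + apply: eq_Rintegral => x _; rewrite (@ulimD _ _ _ 1) => [|n|n].
    * by rewrite !(@ulimM _ _ _ 1)// => n.
    * by rewrite normrM mulr_ile1.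
    * by rewrite normrM mulr_ile1.
  + by move=> n; apply: measurable_funD; apply: measurable_funM => //;
      exact: measurableT_comp.
  + by move=> n x; apply: le_trans (ler_normD _ _) _; apply: lerD; rewrite normrM mulr_ile1.
- move=> h.
  rewrite /im_corr /= -(@Rintegral_loeb _ _ _ mu (fun n x =>
    sys_v (sys_act h x) * sys_u x - sys_u (sys_act h x) * sys_v x) 2).
  + apply: eq_Rintegral => x _; rewrite (@ulimB _ _ _ 1) => [|n|n].
    * by rewrite !(@ulimM _ _ _ 1)// => n.
    * by rewrite normrM mulr_ile1.
    * by rewrite normrM mulr_ile1.
  + by move=> n; apply: measurable_funB; apply: measurable_funM => //;
      exact: measurableT_comp.
  + by move=> n x; apply: le_trans (ler_normB _ _) _; apply: lerD; rewrite normrM mulr_ile1.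
Qed.

Lemma vdC_upto_finite (e : R) (H : set G) : countable [set: G] ->
  vdC_upto 0 H -> 0 < e ->
  exists K, [/\ finite_set K, K `<=` H & vdC_upto e K].
Proof.
move=> /countable_injP[p pinj] vH e0; apply: contrapT => noK.
pose K n := [set h | H h /\ (p h < n)%N].
have finK n : finite_set (K n).
  apply: (@sub_finite_set _ _ (p @^-1` `I_n)) => [h []//|].
  by apply: finite_preimage => // g h _ _; apply: pinj; rewrite in_setT.
(* Adding the two absolute values turns the failure of a conjunction of bounds into a single
   inequality, which survives the ultralimit. *)
have /choice[s sP] : forall n, exists s, kills s (K n) /\
    e <= `|\int[sys_mu s]_x sys_u x| + `|\int[sys_mu s]_x sys_v x|.
  move=> n; apply: contrapT => nos; apply: noK; exists (K n); split => //.
    by move=> h [].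
  move=> s sK; have /negP : ~ e <= `|\int[sys_mu s]_x sys_u x| + `|\int[sys_mu s]_x sys_v x|.
    by move=> es; apply: nos; exists s.
  rewrite -ltNge => se; split; apply: le_trans (ltW se).
    by rewrite lerDl.
  by rewrite lerDr.
have [t [tu tv tre tim]] := limit_system s.
have [] : `|\int[sys_mu t]_x sys_u x| <= 0 /\ `|\int[sys_mu t]_x sys_v x| <= 0.
  apply: vH => h Hh; rewrite tre tim.
  (* Each [h] in [H] belongs to [K n] as soon as [n] exceeds [p h], so its correlations vanish for
     [ultra]-many [n]. *)
  have Kh : ultra [set n | K n h].
    by apply: filterS (ultra_geq (p h).+1) => n /= hn.
  split.
    rewrite (@eq_ulim _ _ (fun=> 0)) ?ulim_cst//.
    by apply: filterS Kh => n /= /((sP n).1 h)[].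
  rewrite (@eq_ulim _ _ (fun=> 0)) ?ulim_cst//.
  by apply: filterS Kh => n /= /((sP n).1 h)[].
have u1 n : `|\int[sys_mu (s n)]_x sys_u x| <= 1.
  exact: normr_Rintegral_le (@sys_mu_fun _) (@sys_u1 _).
have v1 n : `|\int[sys_mu (s n)]_x sys_v x| <= 1.
  exact: normr_Rintegral_le (@sys_mv_fun _) (@sys_v1 _).
rewrite tu tv -(ulim_norm u1) -(ulim_norm v1) => u0 v0.
suff : e <= ulim (fun n => `|\int[sys_mu (s n)]_x sys_u x|) +
    ulim (fun n => `|\int[sys_mu (s n)]_x sys_v x|).
  by rewrite leNgt => /negP; apply; rewrite (le_lt_trans _ e0)// -[leRHS]addr0 lerD.
rewrite -(@ulimD _ _ _ 1) => [|n|n]; rewrite ?normr_id//.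
rewrite -[leLHS]ulim_cst; apply: (@ler_ulim _ _ _ (`|e| + 2)) => [n|n|].
- by rewrite lerDl.
- apply: le_trans (ler_normD _ _) _; rewrite !normr_id.
  by rewrite ler_wpDl// lerD.
- by apply: filterE => n /=; exact: (sP n).2.
Qed.

End system.

(** * Passing between vdC sets and bounded systems *)

Lemma Re_mul_conjc (R : rcfType) (a b : R[i]) : complex.Re (a * conjc b) =
  complex.Re a * complex.Re b + complex.Im a * complex.Im b.
Proof. by case: a b => [a1 a2] [b1 b2] /=; rewrite mulrN opprK. Qed.

Lemma Im_mul_conjc (R : rcfType) (a b : R[i]) : complex.Im (a * conjc b) =
  complex.Im a * complex.Re b - complex.Re a * complex.Im b.
Proof. by case: a b => [a1 a2] [b1 b2] /=; rewrite mulrN addrC. Qed.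

Section vdC_systems.
Context (R : realType) (G : groupType).
Implicit Types (H : set G).

Lemma vdC_set_upto H : vdC_set R H -> vdC_upto (R := R) 0 H.
Proof.
move=> [_ vH] s sH.
suff : complex_integral (sys_mu s) (fun x => Complex (sys_u x) (sys_v x)) = 0.
  by case=> -> ->; rewrite normr0.
apply: vH (sys_mpa s) _ _ _.
- split; first by split; [exact: sys_mu_fun|exact: sys_mv_fun].
  rewrite /finite_norm unlock; case: ifP => // _.
  apply: (@le_lt_trans _ _ 2%:E); last exact: ltry.
  apply/ess_supP; apply: aeW => x /=; rewrite lee_fin ger0_norm ?sqrtr_ge0//.
  rewrite -(@ger0_norm _ 2)// -sqrtr_sqr ler_wsqrtr//.
  have /ler_normlP[? ?] := sys_u1 x; have /ler_normlP[? ?] := sys_v1 x.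
  by nra.
- move=> h /sH[re0 im0]; rewrite /complex_integral.
  congr Complex.
    rewrite -[RHS]re0; apply: eq_Rintegral => x _.
    exact: Re_mul_conjc.
  rewrite -[RHS]im0; apply: eq_Rintegral => x _.
  exact: Im_mul_conjc.
Qed.

Lemma ess_bounded_normc d (X : measurableType d) (mu : probability X R)
    (f : X -> R[i]) : complex_Linfty mu f ->
  exists M : R, [/\ 0 < M,
    measurable [set x | `|complex.Re (f x)| <= M /\ `|complex.Im (f x)| <= M] &
    mu (~` [set x | `|complex.Re (f x)| <= M /\ `|complex.Im (f x)| <= M]) = 0%E].
Proof.
(* The norm with exponent infinity is defined by cases on the total mass being positive; for a
   probability the other case is absurd. *)
move=> [[mRe mIm]]; rewrite /finite_norm unlock; case: ifP => [_ f_lty|/negP[]]; last first.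
  by have : (0 < 1 :> \bar R)%E by []; rewrite -(probability_setT mu).
have [M [M0 fM]] : exists M : R, 0 < M /\
    (ess_sup mu (abse \o (EFin \o (fun x => ComplexField.Normc.normc (f x)))) <= M%:E)%E.
  move: f_lty; case: (ess_sup _ _) => [r _|//|_].
  - by exists (`|r| + 1); rewrite lee_fin; split; [|rewrite ler_wpDr// ler_norm].
  - by exists 1; rewrite leNye.
exists M.
have mS : measurable [set x | `|complex.Re (f x)| <= M /\ `|complex.Im (f x)| <= M].
  have mle (g : X -> R) : measurable_fun setT g -> measurable [set x | `|g x| <= M].
    move=> mg; rewrite (_ : [set x | _] = g @^-1` `[- M, M]%classic).
      by rewrite -[X in measurable X]setTI; exact: mg.
    by apply/seteqP; split => x; rewrite /= in_itv/= ler_norml.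
  by apply: measurableI; exact: mle.
have mSC := measurableC mS.
split => //.
have /ess_supP fA0 := fM; have [A [mA A0 fA]] := fA0.
apply: (@subset_measure0 _ _ _ mu _ A mSC mA _ A0).
apply: subset_trans fA => x /= nM xM; apply: nM; move: xM.
rewrite lee_fin ger0_norm; last by case: (f x) => a b; exact: sqrtr_ge0.
case: (f x) => a b /=; move=> abM.
have sq (c e : R) : 0 <= e -> c ^+ 2 + e <= M ^+ 2 -> `|c| <= M.
  move=> e0 ceM; rewrite -(@ler_pXn2r _ 2) ?nnegrE//; last exact: ltW.
  by rewrite real_normK ?num_real// (le_trans _ ceM)// lerDl.
have abM2 : a ^+ 2 + b ^+ 2 <= M ^+ 2.
  by rewrite -(@sqr_sqrtr _ (_ + _)) ?addr_ge0 ?sqr_ge0// ler_pXn2r// nnegrE ?sqrtr_ge0// ltW.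
split; first exact: sq (sqr_ge0 b) abM2.
by apply: (sq _ _ (sqr_ge0 a)); rewrite addrC.
Qed.

Lemma eq_Rintegral_null d (X : measurableType d) (mu : probability X R)
    (f g : X -> R) (A : set X) :
  measurable_fun setT f -> measurable_fun setT g -> measurable A ->
  mu (~` A) = 0%E -> {in A, f =1 g} -> \int[mu]_x f x = \int[mu]_x g x.
Proof.
move=> mf mg mA A0 fg; rewrite /Rintegral; congr fine.
apply: ae_eq_integral => //; [exact/measurable_EFinP|exact/measurable_EFinP|].
exists (~` A); split => //; first exact: measurableC.
by move=> x /= + Ax; apply => _; rewrite fg// mem_set.
Qed.

Lemma Rintegral_scaled_null d (X : measurableType d) (mu : probability X R)
    (f g : X -> R) (A : set X) (c K : R) :
  measurable_fun setT f -> measurable_fun setT g -> measurable A ->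
  mu (~` A) = 0%E -> (forall x, `|g x| <= K) -> (forall x, A x -> f x = c * g x) ->
  \int[mu]_x f x = c * \int[mu]_x g x.
Proof.
move=> mf mg mA A0 gK fg; rewrite -RintegralZl//; last exact: bounded_integrable gK.
apply: (@eq_Rintegral_null _ _ _ _ _ A) => //; first exact: measurable_funM.
by move=> x /set_mem; exact: fg.
Qed.

(** An essentially bounded [f] is cut off outside a set [S] of full measure and divided by its bound
    [M]. This divides integrals by [M] and correlations by [M ^+ 2], so the rescaled function is
    admissible for every [e]. *)
Lemma vdC_upto_set H : H `<=` ~` [set 1%g] ->
  (forall e : R, 0 < e -> vdC_upto (R := R) e H) -> vdC_set R H.
Proof.
move=> H1 vH; split => // d X mu T mpaT f fL fH.
have [M [M0 mS S0]] := ess_bounded_normc fL.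
set S := [set x | _] in mS S0.
have [[mRe mIm] _] := fL.
pose trunc (g : X -> R) x : R := (M^-1 * g x) * \1_S x.
have mtrunc g : measurable_fun setT g -> measurable_fun setT (trunc g).
  move=> mg; apply: measurable_funM; last exact: measurable_indic.
  by apply: measurable_funM.
have trunc1 g : (forall x, S x -> `|g x| <= M) -> forall x, `|trunc g x| <= 1.
  move=> gM x; rewrite /trunc indicE; have [/set_mem Sx|_] := boolP (x \in S).
    by rewrite mulr1 normrM gtr0_norm ?invr_gt0// ler_pdivrMl ?mulr1// gM.
  by rewrite mulr0 normr0.
have truncE g x : S x -> trunc g x = M^-1 * g x.
  by move=> Sx; rewrite /trunc indicE mem_set// mulr1.
pose u := trunc (fun x => complex.Re (f x)); pose v := trunc (fun x => complex.Im (f x)).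
have mu_u : measurable_fun setT u by exact: mtrunc.
have mu_v : measurable_fun setT v by exact: mtrunc.
have u1 : forall x, `|u x| <= 1 by apply: trunc1 => x [].
have v1 : forall x, `|v x| <= 1 by apply: trunc1 => x [].
have ReE : \int[mu]_x complex.Re (f x) = M * \int[mu]_x u x.
  apply: (Rintegral_scaled_null mRe mu_u mS S0 u1) => x Sx.
  by rewrite /u truncE//= mulrA divff ?mul1r// gt_eqF.
have ImE : \int[mu]_x complex.Im (f x) = M * \int[mu]_x v x.
  apply: (Rintegral_scaled_null mIm mu_v mS S0 v1) => x Sx.
  by rewrite /v truncE//= mulrA divff ?mul1r// gt_eqF.
suff [u0 v0] : \int[mu]_x u x = 0 /\ \int[mu]_x v x = 0.
  by rewrite /complex_integral ReE ImE u0 v0 mulr0.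
pose s := System mpaT mu_u mu_v u1 v1.
have nul e : `|e| <= 0 -> e = 0 :> R by rewrite normr_le0 => /eqP.
suff sH : kills s H.
  have small e (e0 : 0 < e) := vH e e0 s sH.
  by split; apply: nul; apply/ler_addgt0Pl => e e0; rewrite addr0; have [] := small e e0.
move=> h Hh; have [reH imH] := fH h Hh.
(* On [A] neither [f x] nor [f (T h x)] is cut off; its complement is null because [T h] preserves
   [mu]. *)
pose A := S `&` T h @^-1` S.
have mTS : measurable (T h @^-1` S).
  by rewrite -[X in measurable X]setTI; exact: (mpa_measurable mpaT).
have mA : measurable A by exact: measurableI.
have A0 : mu (~` A) = 0%E.
  apply/eqP; rewrite eq_le measure_ge0 andbT setCI.
  apply: (@le_trans _ _ (mu (~` S) + mu (~` (T h @^-1` S)))%E).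
    by apply: measureU2; exact: measurableC.
  have -> : mu (~` (T h @^-1` S)) = 0%E.
    by have := mpa_preserving mpaT h (measurableC mS); rewrite S0.
  by rewrite S0 adde0.
have mTg g : measurable_fun setT g -> measurable_fun setT (fun x => g (T h x) : R).
  by move=> mg; apply: measurableT_comp => //; exact: (mpa_measurable mpaT).
have uT := mTg u mu_u; have vT := mTg v mu_v.
have ReT := mTg _ mRe; have ImT := mTg _ mIm.
have scale (w w' : X -> R) : measurable_fun setT w -> measurable_fun setT w' ->
    (forall x, `|w' x| <= 2) -> (forall x, A x -> w x = M ^+ 2 * w' x) ->
    \int[mu]_x w x = 0 -> \int[mu]_x w' x = 0.
  move=> mw mw' w'2 ww' w0; have := Rintegral_scaled_null mw mw' mA A0 w'2 ww'.
  by rewrite w0 => /esym/eqP; rewrite mulf_eq0 sqrf_eq0 gt_eqF// => /eqP.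
split.
- apply: scale reH => /=.
  + under eq_fun do rewrite Re_mul_conjc.
    by apply: measurable_funD; apply: measurable_funM.
  + by apply: measurable_funD; apply: measurable_funM.
  + move=> x; apply: le_trans (ler_normD _ _) _.
    by apply: lerD; rewrite normrM mulr_ile1.
  + move=> x [Sx STx]; rewrite /u /v !truncE//= Re_mul_conjc; field.
    exact: lt0r_neq0.
- apply: scale imH => /=.
  + under eq_fun do rewrite Im_mul_conjc.
    by apply: measurable_funB; apply: measurable_funM.
  + by apply: measurable_funB; apply: measurable_funM.
  + move=> x; apply: le_trans (ler_normB _ _) _.
    by apply: lerD; rewrite normrM mulr_ile1.
  + move=> x [Sx STx]; rewrite /u /v !truncE//= Im_mul_conjc; field.
    exact: lt0r_neq0.
Qed.

End vdC_systems.

(** * Fair coin tosses indexed by a countable set *)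

Definition bits (I : Type) : Type := I -> bool.

HB.instance Definition _ (I : Type) := gen_eqMixin (bits I).
HB.instance Definition _ (I : Type) := gen_choiceMixin (bits I).
HB.instance Definition _ (I : Type) := isPointed.Build (bits I) (fun=> false).

Section cylinders.
Context (I : choiceType).
Implicit Types (s : seq I) (w x : bits I).

Definition cylinder s w : set (bits I) := [set x : bits I | forall i, i \in s -> x i = w i].

(** The empty set is included because incompatible cylinders meet in it; the family is then closed
    under intersection. *)
Definition cylinders : set (set (bits I)) :=
  [set C | C = set0 \/ exists s w, C = cylinder s w].

Lemma cylinders_setI : setI_closed cylinders.
Proof.
move=> A B [->|[s [w ->]]]; first by rewrite set0I; left.
move=> [->|[t [v ->]]]; first by rewrite setI0; left.
have [->|/set0P[x [xw xv]]] := eqVneq (cylinder s w `&` cylinder t v) set0; first by left.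
(* Any point [x] of the intersection can prescribe the values on both lists of coordinates. *)
right; exists (s ++ t), x; apply/seteqP; split => y.
  by move=> [yw yv] i; rewrite mem_cat => /orP[is_|it]; [rewrite xw ?yw|rewrite xv ?yv].
move=> yx; split=> i ?; first by rewrite -xw ?yx// mem_cat; apply/orP; left.
by rewrite -xv ?yx// mem_cat; apply/orP; right.
Qed.

Lemma cylinder0 w : cylinder [::] w = setT.
Proof. by apply/seteqP; split. Qed.

Lemma eq_cylinder s t w : s =i t -> cylinder s w = cylinder t w.
Proof. by move=> st; apply/seteqP; split => x xw i is_; apply: xw; rewrite ?st// -st. Qed.

Lemma cylinder_cons i s w :
  cylinder (i :: s) w = [set x : bits I | x i = w i] `&` cylinder s w.
Proof.
apply/seteqP; split => x.
  by move=> xw; split=> [|j js]; apply: xw; rewrite inE ?eqxx ?js ?orbT.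
by move=> [xi xw] j; rewrite inE => /predU1P[->|/xw].
Qed.

Definition bits_space : measurableType _ := g_sigma_algebraType cylinders.

Lemma measurable_cylinder s w : measurable (cylinder s w : set bits_space).
Proof. by apply: sub_sigma_algebra; right; exists s, w. Qed.

Lemma measurable_fun_bits d (X : measurableType d) (f : X -> bits_space) :
  (forall s w, measurable (f @^-1` cylinder s w)) -> measurable_fun setT f.
Proof.
move=> mf; apply: (@measurability _ _ X bits_space setT f cylinders) => //.
move=> _ [_ [->|[s [w ->]]] <-]; rewrite setTI; last exact: mf.
by rewrite preimage_set0.
Qed.

Definition flips (a : pred I) (x : bits I) : bits I := fun i => x i (+) a i.

Lemma preimage_flips a s w : flips a @^-1` cylinder s w = cylinder s (flips a w).
Proof.
apply/seteqP; split => x xw i /xw; rewrite /flips; first by move=> <-; rewrite addbK.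
by move=> ->; rewrite addbK.
Qed.

Lemma measurable_flips a : measurable_fun setT (flips a : bits_space -> bits_space).
Proof.
by apply: measurable_fun_bits => s w; rewrite preimage_flips; exact: measurable_cylinder.
Qed.

End cylinders.

Section average.
Context (R : realType) d (X : measurableType d) (P : probability X R).
Context (f : {mfun X >-> X}).

(** The average of [P] and its image under [f]. With [f] flipping one bit, it makes that bit fair
    and independent of the others. *)
Definition average_pushforward : set X -> \bar R :=
  mscale ((2 : R)^-1%:nng) (measure_add P (distribution P f)).

HB.instance Definition _ := Measure.on average_pushforward.

Lemma average_pushforwardE A :
  average_pushforward A = ((2^-1)%:E * (P A + P (f @^-1` A)))%E.
Proof. by congr (_ * _)%E; exact: measure_addE. Qed.

Lemma average_pushforward_setT : average_pushforward setT = 1%E.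
Proof.
rewrite average_pushforwardE preimage_setT probability_setT -EFinD -EFinM.
by congr EFin; rewrite mulVf.
Qed.

HB.instance Definition _ := Measure_isProbability.Build _ _ _
  average_pushforward average_pushforward_setT.

End average.

(** Start from a point mass and randomize one coordinate at a time: averaging with the flip of the
    coordinate numbered [n] makes it fair and leaves the earlier ones as they were. *)
Lemma fair_bits_finite (R : realType) (I : choiceType) (p : I -> nat) n :
  injective p -> exists P : probability (bits_space I) R,
  forall s w, uniq s -> (forall i, i \in s -> (p i < n)%N) ->
    P (cylinder s w) = (2^-1 ^+ size s)%:E.
Proof.
move=> pinj; elim: n => [|n [P PE]].
  exists (dirac ((fun=> false) : bits_space I)) => s w _.
  case: s => [_|i s /(_ i)]; last by rewrite inE eqxx => /(_ isT).
  by rewrite cylinder0 expr0; exact: diracT.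
pose a : pred I := fun i => p i == n.
pose f : {mfun bits_space I >-> bits_space I} := mfun_Sub (mem_set (measurable_flips a)).
exists (average_pushforward P f) => s w us sn.
rewrite /= average_pushforwardE preimage_flips.
have [/hasP[i is_ /eqP pin]|/hasPn an] := boolP (has a s).
  have /perm_to_rem ps := is_.
  have ui : uniq (i :: rem i s) by rewrite -(perm_uniq ps).
  have si : s =i i :: rem i s by exact: perm_mem.
  have sz : size s = (size (rem i s)).+1 by rewrite (perm_size ps).
  move: (rem i s) ps ui si sz => t _ /andP[nit ut] si ->.
  rewrite !(eq_cylinder _ si).
  have tn j : j \in t -> (p j < n)%N.
    move=> jt; have := sn j; rewrite si inE jt orbT => /(_ isT).
    rewrite ltnS leq_eqVlt => /orP[/eqP pjn|//].
    by move: nit; rewrite (pinj i j) ?jt// pin pjn.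
  have E : cylinder t (flips a w) = cylinder t w.
    apply/seteqP; split => x xw j jt; rewrite xw// /flips;
    by rewrite /a (ltn_eqF (tn j jt)) addbF.
  have mC v : measurable ([set x | x i = v i] `&` cylinder t w : set (bits_space I)).
    rewrite (_ : _ `&` _ = cylinder (i :: t) (fun j => if j == i then v i else w j)).
      exact: measurable_cylinder.
    rewrite cylinder_cons eqxx; congr (_ `&` _).
    apply/seteqP; split => x xw j jt; rewrite xw//;
      by case: eqP jt nit => // -> ->.
  (* The flipped prescription asks for the opposite value of bit [i], so the two pieces partition
     [cylinder t w]; half of its measure is the claim. *)
  have PU : P (([set x | x i = w i] `&` cylinder t w) `|`
      ([set x | x i = flips a w i] `&` cylinder t w)) =
      (P ([set x | x i = w i] `&` cylinder t w) +
       P ([set x | x i = flips a w i] `&` cylinder t w))%E.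
    apply: measureU => //.
    by apply/seteqP; split => // x [[/= -> _] [+ _]]; rewrite /= /flips /a pin eqxx; case: (w i).
  rewrite !cylinder_cons E -PU -setIUl (_ : _ `|` _ = setT).
    by rewrite setTI PE// exprS.
  apply/seteqP; split => x // _ /=; rewrite /flips /a pin eqxx addbT.
  by case: (x i) (w i) => -[]; [left|right|right|left].
have sn' i : i \in s -> (p i < n)%N.
  by move=> is_; rewrite ltn_neqAle (an i is_)// -ltnS sn.
rewrite (_ : cylinder s (flips a w) = cylinder s w).
  by rewrite PE// -EFinD -EFinM; congr EFin; field.
by apply/seteqP; split => x xw j js; rewrite xw// /flips /a (ltn_eqF (sn' j js)) addbF.
Qed.

(** The infinite product measure is the law, under the Loeb measure of the finite stages, of the
    ultralimit of each bit. The preimage of a cylinder is internal, and from some stage on its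
    measure is constant. *)
Lemma fair_bits (R : realType) (I : choiceType) :
  countable [set: I] -> exists P : probability (bits_space I) R,
  forall s w, uniq s -> P (cylinder s w) = (2^-1 ^+ size s)%:E.
Proof.
move=> /countable_injP[p pinj].
have {}pinj : injective p by move=> i j; apply: pinj; rewrite in_setT.
have /choice[P PE] := fun n => @fair_bits_finite R I p n pinj.
pose X (_ : nat) := bits_space I.
pose u (x : loeb_space X) : bits_space I := fun i => `[< ultra [set n | x n i] >].
have uE s w : u @^-1` cylinder s w = internal (fun n : nat => cylinder s w : set (X n)).
  apply/seteqP; split => x.
  - elim: s => [|i s IH].
      by move=> _; apply: filterE.
    rewrite cylinder_cons => -[xi /IH xs].
    have {}xi : ultra [set n | x n i = w i].
      move: xi; rewrite /u /=; case: (w i) => [/asboolP//|/asboolPn/ultraN].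
      by apply: filterS => n /= /negP/negbTE.
    by apply: filterS (ultraI xi xs).
  - move=> xs i is_.
    have {}xs : ultra [set n | x n i = w i] by apply: filterS xs => n; exact.
    rewrite /u /=; move: xs; case: (w i); first by move=> ?; apply/asboolP.
    by move=> xi; apply/asboolPn/ultraN; apply: filterS xi => n /= ->.
have mu_u : measurable_fun setT u.
  apply: measurable_fun_bits => s w; rewrite uE.
  by apply: measurable_internal => n; exact: measurable_cylinder.
pose U : {mfun loeb_space X >-> bits_space I} := mfun_Sub (mem_set mu_u).
exists (distribution (loeb P) U) => s w us.
rewrite /distribution/= /pushforward uE loebE; last by move=> n; exact: measurable_cylinder.
rewrite (@eq_ulim _ _ (fun=> 2^-1 ^+ size s)) ?ulim_cst//.
(* Beyond this stage all coordinates listed in [s] are fair. *)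
apply: filterS (ultra_geq (\max_(i <- s) (p i)).+1) => n /= sn; rewrite PE//.
by move=> i is_; rewrite (leq_trans _ sn)// ltnS leq_bigmax_seq.
Qed.

(** * The Bernoulli shift *)

Section shift.
Context (R : realType) (G : groupType).

(** The inverse makes this a left action when [G] is not commutative. *)
Definition shift (g : G) (x : bits_space G) : bits_space G :=
  fun i => x (g^-1 * i)%g.

Lemma preimage_shift g s w : shift g @^-1` cylinder s w =
  cylinder [seq (g^-1 * i)%g | i <- s] (fun i => w (g * i)%g).
Proof.
apply/seteqP; split => x xw i.
  by case/mapP => j js ->; rewrite mulVKg -(xw j js).
by move=> is_; rewrite /shift xw ?mulVKg//; exact: map_f.
Qed.

Lemma measurable_shift g : measurable_fun setT (shift g).
Proof.
by apply: measurable_fun_bits => s w; rewrite preimage_shift; exact: measurable_cylinder.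
Qed.

Lemma shift_preserving (P : probability (bits_space G) R) :
  (forall s w, uniq s -> P (cylinder s w) = (2^-1 ^+ size s)%:E) ->
  measure_preserving_action P shift.
Proof.
move=> PE; split.
- by move=> x; apply/funext => i; rewrite /shift invg1 mul1g.
- by move=> g h x; apply/funext => i; rewrite /shift invgM mulgA.
- exact: measurable_shift.
move=> g A mA.
pose m1 : {measure set (bits_space G) -> \bar R} := pushforward P (shift g).
apply: (@measure_unique _ R (bits_space G) (@cylinders G) (fun=> setT) _ _ _ _
  (m1 (@measurable_shift g)) P) => //.
- exact: cylinders_setI.
- by move=> _; right; exists [::], (fun=> false); rewrite cylinder0.
- by rewrite bigcup_const//; exists 0%N.
- move=> _ [->|[s [w ->]]]; first by rewrite !measure0.
  (* The formula for [P] concerns lists without repetition; translation by [g^-1] is injective and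
     keeps them so. *)
  rewrite -(@eq_cylinder _ (undup s)); last exact: mem_undup.
  rewrite [LHS](_ : _ = P (shift g @^-1` cylinder (undup s) w))// preimage_shift PE.
    by rewrite size_map; exact/esym/PE/undup_uniq.
  by rewrite map_inj_uniq ?undup_uniq//; exact: mulgI.
- move=> _; have -> : m1 (@measurable_shift g) setT = 1%E := probability_setT P.
  exact: ltry.
Qed.

(* A fair coin is tossed at each element of [G]; the event is heads at [1] and
   tails at [h], which is incompatible with its translate by [h]. *)
Lemma disjoint_translate (h : G) : countable [set: G] -> h <> 1%g ->
  exists (P : probability (bits_space G) R) (B : set (bits_space G)),
  [/\ measure_preserving_action P shift, measurable B,
      P B = (4^-1)%:E & B `&` shift h @^-1` B = set0].
Proof.
move=> cG h1; have [P PE] := fair_bits R cG.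
pose B := cylinder [:: 1%g; h] (fun i : G => i == 1%g).
exists P, B; split.
- exact: shift_preserving.
- exact: measurable_cylinder.
- rewrite PE/=; last by rewrite inE andbT eq_sym; exact/eqP.
  by congr EFin; field.
- apply/seteqP; split => // x [B1 B2].
  have := B2 h; rewrite !inE eqxx orbT /shift mulVg => /(_ isT).
  have := B1 1%g; rewrite !inE eqxx => /(_ isT) ->.
  by move/eqP: h1 => /negbTE ->.
Qed.

End shift.

(** * Products of systems *)

Section product.
Context (R : realType) d1 d2 (X : measurableType d1) (Y : measurableType d2).
Context (mu : probability X R) (nu : probability Y R).

Definition product_probability : set (X * Y) -> \bar R := (mu \x nu)%E.

HB.instance Definition _ := Measure.on product_probability.

Lemma product_probability_setT : product_probability setT = 1%E.
Proof.
rewrite /product_probability -setXTT product_measure1E// -[RHS]mule1.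
by congr (_ * _)%E; exact: probability_setT.
Qed.

HB.instance Definition _ := Measure_isProbability.Build _ _ _
  product_probability product_probability_setT.

Lemma Rintegral_product_indic (F : X -> R) (C : set Y) (M : R) :
  measurable_fun setT F -> (forall x, `|F x| <= M) -> measurable C ->
  \int[product_probability]_z (F z.1 * \1_C z.2) = \int[mu]_x F x * fine (nu C).
Proof.
move=> mF FM mC.
have M0 : 0 <= M by rewrite (le_trans _ (FM point)).
have mf : measurable_fun setT (fun z : X * Y => F z.1 * \1_C z.2).
  apply: measurable_funM; first exact: measurableT_comp.
  by apply: measurableT_comp => //; exact: measurable_indic.
have fM (z : X * Y) : `|F z.1 * \1_C z.2| <= M.
  rewrite normrM -[leRHS]mulr1 ler_pM// indicE.
  by case: (_ \in _); rewrite ?normr1 ?normr0.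
have := bounded_integrable product_probability mf fM.
move=> /(integral12_prod_meas1 (m1 := mu) (m2 := nu)).
rewrite /Rintegral => <-.
rewrite -RintegralZr//; last exact: bounded_integrable FM.
congr fine; apply: eq_integral => x _; rewrite /fubini_F.
under eq_integral do rewrite /= EFinM.
rewrite integralZl//; last first.
  apply: (@bounded_integrable _ _ _ nu _ 1); first exact: measurable_indic.
  by move=> y; rewrite indicE; case: (_ \in _); rewrite ?normr1 ?normr0.
rewrite integral_indic// setIT EFinM fineK//; exact: fin_num_measure.
Qed.

Lemma product_action (G : groupType) (T : G -> X -> X) (S : G -> Y -> Y) :
  measure_preserving_action mu T -> measure_preserving_action nu S ->
  measure_preserving_action product_probability (fun g z => (T g z.1, S g z.2)).
Proof.
move=> aT aS; split.
- by move=> [x y] /=; rewrite (mpa_one aT) (mpa_one aS).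
- by move=> g h [x y] /=; rewrite (mpa_mul aT) (mpa_mul aS).
- move=> g; apply: measurable_fun_pair; apply: measurableT_comp => //.
    exact: (mpa_measurable aT).
  exact: (mpa_measurable aS).
move=> g A mA.
have mTS : measurable_fun setT (fun z : X * Y => (T g z.1, S g z.2)).
  apply: measurable_fun_pair; apply: measurableT_comp => //.
    exact: (mpa_measurable aT).
  exact: (mpa_measurable aS).
pose m1 : {measure set (X * Y) -> \bar R} :=
  pushforward product_probability (fun z : X * Y => (T g z.1, S g z.2)).
(* A measure with the product values on rectangles is the product measure. *)
suff E : forall B C, measurable B -> measurable C ->
    (m1 mTS (B `*` C) = mu B * nu C)%E.
  exact/esym/(product_measure_unique (m1 := mu) (m2 := nu) (m' := m1 mTS) E).
move=> B C mB mC.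
have mTB : measurable (T g @^-1` B).
  by rewrite -[X in measurable X]setTI; exact: (mpa_measurable aT).
have mSC : measurable (S g @^-1` C).
  by rewrite -[X in measurable X]setTI; exact: (mpa_measurable aS).
rewrite -(mpa_preserving aT g mB) -(mpa_preserving aS g mC).
exact: (product_measure1E mu nu mTB mSC).
Qed.

End product.

(** * Deleting finitely many points *)

Section removal.
Context (R : realType) (G : groupType).
Implicit Types (H K D : set G).

Lemma sub_vdC_upto (e : R) H K : H `<=` K -> vdC_upto e H -> vdC_upto e K.
Proof. by move=> HK vH s sK; apply: vH => h /HK; exact: sK. Qed.

(** The correlation at [g] of the function times the indicator of [B] factors into that of [s] and
    the measure of [B] met with its preimage under [shift g]. The second factor vanishes at [h], the
    first on the rest of [H]. *)
Lemma vdC_upto_setD1 H (h : G) : countable [set: G] -> h <> 1%g ->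
  vdC_upto (R := R) 0 H -> vdC_upto (R := R) 0 (H `\ h).
Proof.
move=> cG h1 vH s sH.
have [P [B [aP mB PB Bh]]] := disjoint_translate R cG h1.
have aT := product_action (sys_mpa s) aP.
pose X := sys_space s.
pose ext (w : X -> R) (z : X * bits_space G) : R := w z.1 * \1_B z.2.
have mext w : measurable_fun setT w -> measurable_fun setT (ext w).
  move=> mw; apply: measurable_funM; first exact: measurableT_comp.
  by apply: measurableT_comp => //; exact: measurable_indic.
have ext1 (w : X -> R) : (forall x, `|w x| <= 1) -> forall z, `|ext w z| <= 1.
  move=> w1 z; rewrite normrM mulr_ile1// indicE.
  by case: (_ \in _); rewrite ?normr1 ?normr0.
have mT g := mpa_measurable (sys_mpa s) g.
have mBg g : measurable (B `&` shift g @^-1` B).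
  apply: measurableI => //; rewrite -[X in measurable X]setTI.
  exact: (mpa_measurable aP).
pose t := System aT (mext _ (@sys_mu_fun _ _ s)) (mext _ (@sys_mv_fun _ _ s))
  (ext1 _ (@sys_u1 _ _ s)) (ext1 _ (@sys_v1 _ _ s)).
have int_ext (w : X -> R) : measurable_fun setT w -> (forall x, `|w x| <= 1) ->
    \int[product_probability (sys_mu s) P]_z ext w z = \int[sys_mu s]_x w x * 4^-1.
  by move=> mw w1; rewrite (Rintegral_product_indic _ _ mw w1)// PB.
have indB g y : \1_B (shift g y) * \1_B y = \1_(B `&` shift g @^-1` B) y :> R.
  rewrite !indicE -natrM mulnb; congr (_%:R); rewrite in_setI andbC.
  by congr andb; apply/idP/idP => /set_mem ?; apply/mem_set.
have mu_ := @sys_mu_fun _ _ s; have mv_ := @sys_mv_fun _ _ s.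
have u1 := @sys_u1 _ _ s; have v1 := @sys_v1 _ _ s.
have reE g : re_corr t g = re_corr s g * fine (P (B `&` shift g @^-1` B)).
  rewrite /re_corr /= -(@Rintegral_product_indic _ _ _ _ _ _ _ _ _ 2)//.
  - apply: eq_Rintegral => z _; rewrite -indB /ext /=; ring.
  - by apply: measurable_funD; apply: measurable_funM => //; exact: measurableT_comp.
  - move=> x; apply: le_trans (ler_normD _ _) _.
    by apply: lerD; rewrite normrM mulr_ile1.
have imE g : im_corr t g = im_corr s g * fine (P (B `&` shift g @^-1` B)).
  rewrite /im_corr /= -(@Rintegral_product_indic _ _ _ _ _ _ _ _ _ 2)//.
  - apply: eq_Rintegral => z _; rewrite -indB /ext /=; ring.
  - by apply: measurable_funB; apply: measurable_funM => //; exact: measurableT_comp.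
  - move=> x; apply: le_trans (ler_normB _ _) _.
    by apply: lerD; rewrite normrM mulr_ile1.
have : kills t H.
  move=> g Hg; rewrite reE imE; have [->|gh] := pselect (g = h).
    by rewrite Bh measure0 !mulr0.
  by have [-> ->] := sH g (conj Hg gh); rewrite !mul0r.
(* The integrals of [t] are those of [s] times [4^-1], and this positive factor cancels. *)
move=> /vH[]; rewrite /= !int_ext// !normrM !pmulr_lle0 ?normr_gt0//.
Qed.

Lemma vdC_upto_setD H D : countable [set: G] -> H `<=` ~` [set 1%g] ->
  finite_set D -> vdC_upto (R := R) 0 H -> vdC_upto (R := R) 0 (H `\` D).
Proof.
move=> cG H1 /finite_seqP[l ->] vH; elim: l => [|h l IH].
  by apply: sub_vdC_upto vH => g Hg; split.
(* The identity is treated apart because no event is disjoint from its translate by it; it is not in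
   [H] anyway. *)
have [h1|h1] := pselect (h = 1%g).
  apply: sub_vdC_upto IH => g [Hg gl]; split=> //=; rewrite inE => /orP[/eqP gh|//].
  by apply: (H1 _ Hg); rewrite /= gh h1.
apply: sub_vdC_upto (vdC_upto_setD1 cG h1 IH) => g [[Hg gl] gh]; split=> //=.
by rewrite inE => /orP[/eqP|].
Qed.

(** The constant 1 on a point mass with trivial action meets the empty list of conditions. This
    later shows that the pieces are nonempty, hence distinct. *)
Lemma vdC_upto_set0 (e : R) : vdC_upto e (set0 : set G) -> 1 <= e.
Proof.
move=> v0; pose mu : probability (bits_space G) R := dirac (point : bits_space G).
have act : measure_preserving_action mu (fun (g : G) x => x) by split.
have one1 (x : bits_space G) : `|1 : R| <= 1 by rewrite normr1.
have m1 : measurable_fun setT (fun _ : bits_space G => 1 : R) by [].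
have [//|] := v0 (System act m1 m1 one1 one1).
by rewrite /= Rintegral_cst_probability normr1.
Qed.

End removal.

(** * Disjoint finite pieces and their regrouping *)

Lemma vdC_disjoint_sequence (R : realType) (G : groupType) (H : set G) :
  countable [set: G] -> vdC_set R H ->
  exists K : nat -> set G, [/\ forall n, K n `<=` H,
    forall m n, (m < n)%N -> K m `&` K n = set0 &
    forall n, vdC_upto (n.+1%:R^-1 : R) (K n)].
Proof.
move=> cG vH; have H1 := vH.1.
(* The choice takes the forbidden set and the precision as arguments, so that [D], the union of the
   earlier pieces, is a plain recursion. Finiteness sits after the existential to make [k] total,
   with [set0] as default. *)
have /choice[k kP] : forall Dn : set G * nat, exists K, finite_set Dn.1 ->
    [/\ finite_set K, K `<=` H `\` Dn.1 & vdC_upto (Dn.2.+1%:R^-1 : R) K].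
  move=> [D n]; have [finD|] := pselect (finite_set D); last by exists set0.
  have [|K KP] := vdC_upto_finite (e := n.+1%:R^-1) cG
    (vdC_upto_setD cG H1 finD (vdC_set_upto vH)); first by rewrite invr_gt0.
  by exists K.
pose D := fix D n := if n is m.+1 then D m `|` k (D m, m) else set0.
have finD n : finite_set (D n).
  elim: n => [|n IH] /=; first exact: finite_set0.
  by rewrite finite_setU; split=> //; have [] := kP (D n, n) IH.
exists (fun n => k (D n, n)); split.
- by move=> n; have [_ + _] := kP (D n, n) (finD n); move=> kD g /kD[].
- move=> m n mn; apply/seteqP; split => // g [gm gn].
  have [_ /(_ _ gn)[_ nD] _] := kP (D n, n) (finD n); apply: nD => /=.
  have {gn}: D m.+1 g by right.
  elim: n mn => // n IH; rewrite ltnS leq_eqVlt => /orP[/eqP->//|mn gD].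
  by left; exact: IH.
- by move=> n; have [] := kP (D n, n) (finD n).
Qed.

Unset Implicit Arguments.

Theorem proposition6p4 (R : realType) (G : groupType)
    (cG : countable [set: G]) (iG : infinite_set [set: G])
    (H : set G) (vH : vdC_set R H) :
  exists F : set (set G),
    [/\ infinite_set F,
        forall K L : set G, F K -> F L -> K <> L -> K `&` L = set0 &
        forall K : set G, F K -> K `<=` H /\ vdC_set R K].
Proof.
have [K [KH Kdisj Kvdc]] := vdC_disjoint_sequence cG vH.
(* The 2-adic valuation of [n.+1] splits the indices into infinitely many infinite classes. *)
pose L i := \bigcup_(n in [set n | logn 2 n.+1 = i]) K n.
have LH i : L i `<=` H by move=> g [n _]; exact: KH.
have Ldisj i j : i <> j -> L i `&` L j = set0.
  move=> ij; apply/seteqP; split => // g [[m mi gm] [n nj gn]].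
  have [mn|mn|mn] := ltngtP m n.
  - by rewrite -(Kdisj m n mn).
  - by rewrite -(Kdisj n m mn).
  - by apply: ij; rewrite -mi -nj mn.
have Lvdc i : vdC_set R (L i).
  apply: vdC_upto_set => [|e e0]; first exact: subset_trans (LH i) vH.1.
  have [N _ /(_ N (leqnn N)) Ne] := near_infty_natSinv_lt (PosNum e0).
  (* An index of class [i] with [n.+1 >= N.+1]: an odd multiple of [2 ^ i], lowered by one. *)
  pose n := (2 ^ i * N.*2.+1).-1.
  have nE : n.+1 = (2 ^ i * N.*2.+1)%N by rewrite prednK// muln_gt0 expn_gt0.
  have vn : vdC_upto e (K n).
    move=> s /(Kvdc n)[un vn].
    have ne : (n.+1%:R^-1 : R) <= e.
      rewrite (le_trans _ (ltW Ne))// lef_pV2 ?posrE ?ltr0n// ler_nat nE.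
      rewrite (@leq_trans N.*2.+1)// ?leq_pmull ?expn_gt0//.
      by rewrite ltnS -addnn leq_addr.
    by split; [exact: le_trans un _|exact: le_trans vn _].
  apply: sub_vdC_upto vn => g gn; exists n => //=.
  by rewrite nE lognM ?expn_gt0// pfactorK// logn_coprime ?addn0// coprime2n /= odd_double.
(* Equal pieces with different indices would be disjoint from themselves, hence empty, and the empty
   set is not vdC. *)
have Linj : injective L.
  move=> i j Lij; apply: contrapT => /Ldisj; rewrite Lij setIid => L0.
  have := Lvdc j; rewrite L0 => /vdC_set_upto/vdC_upto_set0.
  by rewrite ler10.
exists (range L); split.
- move=> finL; apply: infinite_nat.
  have := @finite_preimage _ _ (range L) L (in2W Linj) finL.
  by rewrite preimage_range.
- by move=> _ _ [i _ <-] [j _ <-] Lij; apply: Ldisj => ij; rewrite ij in Lij.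
- by move=> _ [i _ <-].
Qed.
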